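(* Let $E$ be a Hausdorff locally convex space, let $F$ be a Banach lattice, and let $\Phi:F\to F$ be defined by $\Phi(f)=rf^++sf^-$, for some $r,s\in\mathbb{R}$ with $s\neq -r$. Then $\operatorname{span}\{\Phi\circ\mathbf{g} : \mathbf{g}\in\mathrm{Aff}(E,F)\}$ is dense in $\mathcal{C}(E,F)$. In particular, $\mathrm{vlt}(\mathrm{Aff}(E,F))$ is dense in $\mathcal{C}(E,F)$.
   Context: All vector spaces are real and non-trivial. $f^+=f\vee0$ and $f^-=(-f)\vee0$. $\mathrm{Aff}(E,F)$ is the set of maps $e\mapsto Te+f$ with $T:E\to F$ a continuous linear operator and $f\in F$. $\mathcal{C}(E,F)$ is the vector lattice (pointwise operations) of continuous maps from $E$ to $F$, endowed with the topology of uniform convergence on compact subsets of $E$ (with respect to the norm of $F$). $\mathrm{vlt}(A)$ is the linear sublattice generated by $A$ in $\mathcal{C}(E,F)$ (the smallest linear subspace containing $A$ and closed under the lattice operations). *)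

(* Defs.v *)
From HB Require Import structures.
From mathcomp Require Import all_boot all_order all_algebra.
From mathcomp Require Import all_classical all_reals all_analysis.

Set Implicit Arguments.
Unset Strict Implicit.
Unset Printing Implicit Defensive.

Import Order.TTheory GRing.Theory Num.Theory.
Import numFieldNormedType.Exports.

Local Open Scope classical_set_scope.
Local Open Scope ring_scope.

(* The order is not inherited from [Order.Lattice]: Hierarchy Builder rejects a
   structure that joins the library's lattices and modules, because common
   ancestors are missing below [Num.RealDomain]. *)
HB.mixin Record Lmodule_isVectorLattice (R : numDomainType) V
    & GRing.Lmodule R V := {
  vle : rel V ;
  vjoin : V -> V -> V ;
  vmeet : V -> V -> V ;
  vle_refl : reflexive vle ;
  vle_anti : antisymmetric vle ;
  vle_trans : transitive vle ;
  vle_joinP : forall x y z, vle (vjoin x y) z = vle x z && vle y z ;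
  vle_meetP : forall x y z, vle z (vmeet x y) = vle z x && vle z y ;
  vle_addr : forall z x y, vle x y -> vle (x + z) (y + z) ;
  vle_scale : forall (a : R) x y, 0 <= a -> vle x y -> vle (a *: x) (a *: y) ;
}.

#[short(type="vectorLatticeType")]
HB.structure Definition VectorLattice (R : numDomainType) :=
  { V of GRing.Lmodule R V & Lmodule_isVectorLattice R V }.

Arguments vle_addr {R s} z {x y}.
Arguments vle_scale {R s} a {x y}.
Arguments vle_trans {R s} {y x z} : rename.

Section vector_lattice.
Context {R : numDomainType} {V : vectorLatticeType R}.
Implicit Types (x : V) (A : set V).

Definition vpos x : V := vjoin x 0.
Definition vneg x : V := vjoin (- x) 0.
Definition vabs x : V := vjoin x (- x).

Definition vector_sublattice A :=
  [/\ submod_closed [in A],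
      forall x y, A x -> A y -> A (vjoin x y) &
      forall x y, A x -> A y -> A (vmeet x y)].

Definition vlt A : set V := smallest vector_sublattice A.

End vector_lattice.

Definition linear_span {R : numDomainType} {V : lmodType R} (A : set V) :=
  smallest (fun B : set V => submod_closed [in B]) A.

HB.mixin Record VectorLattice_isBanachLattice (R : numFieldType) F
    & CompleteNormedModule R F & VectorLattice R F := {
  vabs_le_norm : forall x y : F, vle (vabs x) (vabs y) -> `|x| <= `|y| ;
}.

#[short(type="banachLatticeType")]
HB.structure Definition BanachLattice (R : numFieldType) :=
  { F of CompleteNormedModule R F & VectorLattice R F
       & VectorLattice_isBanachLattice R F }.

Section vector_lattice_theory.
Context {R : numFieldType} {V : vectorLatticeType R}.
Implicit Types x y z : V.

Lemma vle_joinl x y : vle x (vjoin x y).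
Proof. by have := vle_refl (vjoin x y); rewrite vle_joinP => /andP[]. Qed.

Lemma vle_joinr x y : vle y (vjoin x y).
Proof. by have := vle_refl (vjoin x y); rewrite vle_joinP => /andP[]. Qed.

Lemma vle_meetl x y : vle (vmeet x y) x.
Proof. by have := vle_refl (vmeet x y); rewrite vle_meetP => /andP[]. Qed.

Lemma vle_meetr x y : vle (vmeet x y) y.
Proof. by have := vle_refl (vmeet x y); rewrite vle_meetP => /andP[]. Qed.

Lemma vjoinC x y : vjoin x y = vjoin y x.
Proof.
by apply: vle_anti; rewrite !vle_joinP !(vle_joinl, vle_joinr).
Qed.

Lemma vle_subl x y z : vle (x - y) z = vle x (z + y).
Proof.
by apply/idP/idP => /vle_addr; [move/(_ y); rewrite subrK|
  move/(_ (- y)); rewrite addrK].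
Qed.

Lemma vleN2 x y : vle x y -> vle (- y) (- x).
Proof.
move=> /(vle_addr (- x - y)).
by rewrite addrA subrr add0r addrCA subrr addr0.
Qed.

Lemma vle_addl z x y : vle x y -> vle (z + x) (z + y).
Proof. by rewrite ![z + _]addrC; exact: vle_addr. Qed.

Lemma vabs_ge0 x : vle 0 (vabs x).
Proof.
have h : vle 0 (vabs x + vabs x).
  apply: (@vle_trans _ _ (vabs x + x)); last first.
    by apply: vle_addl; exact: vle_joinl.
  by have := vle_addr x (vle_joinr x (- x)); rewrite addNr.
have half0 : (0 : R) <= 2^-1 by rewrite invr_ge0.
move: h => /(vle_scale _ half0); rewrite scaler0 -mulr2n -[vabs x *+ 2]scaler_nat scalerA.
by rewrite mulVf ?scale1r// pnatr_eq0.
Qed.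

Lemma vabs_vjoinB x y z : vle (vabs (vjoin x z - vjoin y z)) (vabs (x - y)).
Proof.
have key u v : vle (vjoin u z - vjoin v z) (vabs (u - v)).
  rewrite vle_subl vle_joinP; apply/andP; split.
    apply: (@vle_trans _ _ (vabs (u - v) + v)).
      by rewrite -vle_subl; exact: vle_joinl.
    by apply: vle_addl; exact: vle_joinl.
  have := vle_addr (vjoin v z) (vabs_ge0 (u - v)).
  by rewrite add0r; apply: vle_trans; exact: vle_joinr.
rewrite vle_joinP key/= opprB.
have -> : vabs (x - y) = vabs (y - x) by rewrite /vabs !opprB vjoinC.
exact: key.
Qed.

Lemma vmeetE x y : vmeet x y = - vjoin (- x) (- y).
Proof.
apply: vle_anti; apply/andP; split.
  rewrite -[X in vle X _]opprK; apply: vleN2; rewrite vle_joinP.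
  by rewrite !vleN2 ?(vle_meetl, vle_meetr).
rewrite vle_meetP -{2}(opprK x) -{3}(opprK y).
by rewrite !vleN2 ?(vle_joinl, vle_joinr).
Qed.

End vector_lattice_theory.

Section banach_lattice_theory.
Context {R : realType} {F : banachLatticeType R}.
Implicit Types x y z : F.

Lemma norm_vjoinB x y z : `|vjoin x z - vjoin y z| <= `|x - y|.
Proof. by apply: vabs_le_norm; exact: vabs_vjoinB. Qed.

Lemma cvg_vjoin {T : Type} {G : set_system T} {FG : Filter G} (f g : T -> F)
    (a b : F) : f @ G --> a -> g @ G --> b ->
  (fun t => vjoin (f t) (g t)) @ G --> vjoin a b.
Proof.
move=> fa gb; apply/cvgrPdist_lt => e e0.
have e20 : 0 < e / 2 by rewrite divr_gt0.
near=> t.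
have -> : vjoin a b - vjoin (f t) (g t) =
    (vjoin a b - vjoin (f t) b) + (vjoin b (f t) - vjoin (g t) (f t)).
  by rewrite (vjoinC b) (vjoinC (g t)) addrA subrK.
rewrite [e]splitr (le_lt_trans (ler_normD _ _))// ltrD//.
  rewrite (le_lt_trans (norm_vjoinB _ _ _))//; near: t.
  by move/cvgrPdist_lt: fa; apply.
rewrite (le_lt_trans (norm_vjoinB _ _ _))//; near: t.
by move/cvgrPdist_lt: gb; apply.
Unshelve. all: by end_near. Qed.

Lemma cvg_vmeet {T : Type} {G : set_system T} {FG : Filter G} (f g : T -> F)
    (a b : F) : f @ G --> a -> g @ G --> b ->
  (fun t => vmeet (f t) (g t)) @ G --> vmeet a b.
Proof.
move=> fa gb; under eq_fun do rewrite vmeetE.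
by rewrite vmeetE; apply: cvgN; apply: cvg_vjoin; exact: cvgN.
Qed.

End banach_lattice_theory.

(* An alias, since the library puts no fixed topology on [continuousType]. *)
Definition cts_space (E F : topologicalType) : Type := continuousType E F.

HB.instance Definition _ (E F : topologicalType) := Choice.on (cts_space E F).

HB.instance Definition _ (E : topologicalType) (R : realType)
    (F : banachLatticeType R) :=
  Topological.copy (cts_space E F)
    (initial_topology (id : continuousType E F -> {family compact, E -> F})).

Section cts_space_vector_lattice.
Context {E : topologicalType} {R : realType} {F : banachLatticeType R}.
Implicit Types f g h : cts_space E F.

Let ctsP f : continuous f. Proof. exact: cts_fun. Qed.

Let add_cts f g : continuous (fun x => f x + g x).
Proof. by move=> x; apply: cvgD; exact: ctsP. Qed.

Let opp_cts f : continuous (fun x => - f x).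
Proof. by move=> x; apply: cvgN; exact: ctsP. Qed.

Let scale_cts (a : R) f : continuous (fun x => a *: f x).
Proof. by move=> x; apply: cvgZl_tmp; exact: ctsP. Qed.

Let join_cts f g : continuous (fun x => vjoin (f x) (g x)).
Proof. by move=> x; apply: cvg_vjoin; exact: ctsP. Qed.

Let meet_cts f g : continuous (fun x => vmeet (f x) (g x)).
Proof. by move=> x; apply: cvg_vmeet; exact: ctsP. Qed.

Let zero_cts : continuous (fun _ : E => 0 : F).
Proof. by move=> x; exact: cvg_cst. Qed.

Definition cts_zero : cts_space E F := mkcts zero_cts.
Definition cts_add f g : cts_space E F := mkcts (@add_cts f g).
Definition cts_opp f : cts_space E F := mkcts (@opp_cts f).
Definition cts_scale (a : R) f : cts_space E F := mkcts (@scale_cts a f).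
Definition cts_join f g : cts_space E F := mkcts (@join_cts f g).
Definition cts_meet f g : cts_space E F := mkcts (@meet_cts f g).
Definition cts_le f g : bool := `[< forall x, vle (f x) (g x) >].

Let addA : associative cts_add.
Proof. by move=> f g h; apply/continuousEP => x; exact: addrA. Qed.

Let addC : commutative cts_add.
Proof. by move=> f g; apply/continuousEP => x; exact: addrC. Qed.

Let add0 : left_id cts_zero cts_add.
Proof. by move=> f; apply/continuousEP => x; exact: add0r. Qed.

Let addN : left_inverse cts_zero cts_opp cts_add.
Proof. by move=> f; apply/continuousEP => x; exact: addNr. Qed.

HB.instance Definition _ :=
  GRing.isZmodule.Build (cts_space E F) addA addC add0 addN.

Let scaleA a b f : cts_scale a (cts_scale b f) = cts_scale (a * b) f.
Proof. by apply/continuousEP => x; exact: scalerA. Qed.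

Let scale1 : left_id 1 cts_scale.
Proof. by move=> f; apply/continuousEP => x; exact: scale1r. Qed.

Let scaleDr : right_distributive cts_scale +%R.
Proof. by move=> a f g; apply/continuousEP => x; exact: scalerDr. Qed.

Let scaleDl f : {morph cts_scale^~ f : a b / a + b}.
Proof. by move=> a b; apply/continuousEP => x; exact: scalerDl. Qed.

HB.instance Definition _ := GRing.Zmodule_isLmodule.Build R (cts_space E F)
  scaleA scale1 scaleDr scaleDl.

Let le_refl : reflexive cts_le.
Proof. by move=> f; apply/asboolP => x; exact: vle_refl. Qed.

Let le_anti : antisymmetric cts_le.
Proof.
move=> f g /andP[/asboolP fg /asboolP gf]; apply/continuousEP => x.
by apply: vle_anti; rewrite fg gf.
Qed.

Let le_trans : transitive cts_le.
Proof.
move=> g f h /asboolP fg /asboolP gh; apply/asboolP => x.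
exact: vle_trans (gh x).
Qed.

Let joinP f g h : cts_le (cts_join f g) h = cts_le f h && cts_le g h.
Proof.
apply/asboolP/andP => [fgh|[/asboolP fh /asboolP gh] x].
  by split; apply/asboolP => x; move: (fgh x); rewrite vle_joinP => /andP[].
by rewrite vle_joinP fh gh.
Qed.

Let meetP f g h : cts_le h (cts_meet f g) = cts_le h f && cts_le h g.
Proof.
apply/asboolP/andP => [fgh|[/asboolP fh /asboolP gh] x].
  by split; apply/asboolP => x; move: (fgh x); rewrite vle_meetP => /andP[].
by rewrite vle_meetP fh gh.
Qed.

Let le_add h f g : cts_le f g -> cts_le (f + h) (g + h).
Proof. by move=> /asboolP fg; apply/asboolP => x; exact: vle_addr. Qed.

Let le_scale (a : R) f g : 0 <= a -> cts_le f g -> cts_le (a *: f) (a *: g).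
Proof.
by move=> a0 /asboolP fg; apply/asboolP => x; exact: vle_scale.
Qed.

HB.instance Definition _ := Lmodule_isVectorLattice.Build R (cts_space E F)
  le_refl le_anti le_trans joinP meetP le_add le_scale.

End cts_space_vector_lattice.

Section pos_neg_comb.
Context {R : realType} {F : banachLatticeType R} (r s : R).

Definition pos_neg_comb (f : F) : F := r *: vpos f + s *: vneg f.

Let pos_neg_comb_cts : continuous pos_neg_comb.
Proof.
move=> f; apply: cvgD; apply: cvgZl_tmp; apply: cvg_vjoin.
- exact: cvg_id.
- exact: cvg_cst.
- by apply: cvgN; exact: cvg_id.
- exact: cvg_cst.
Qed.

HB.instance Definition _ := isContinuous.Build F F pos_neg_comb pos_neg_comb_cts.

End pos_neg_comb.

Definition Aff {R : realType} (E : tvsType R) (F : banachLatticeType R)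
    : set (cts_space E F) :=
  [set g : cts_space E F | exists2 T : {linear E -> F}, continuous T &
     exists f : F, forall e, g e = T e + f].
Arguments Aff {R} E F _.

(* Main.v *)
(* For a continuous linear functional T, a scalar c and y >= 0 in F, both sets
   contain e |-> |T e - c| y: the first because Phi(z) + Phi(-z) is
   (r + s) (z^+ + z^-), the second because |z| is z \/ (- z). It is thus enough
   to approximate on a compact set K:
   - exp is a uniform limit, on bounded intervals, of combinations of the
     functions t |-> |t - c|, so the combinations of the functions |T - c|
     approximate exp o T;
   - combinations of the exp o T form an algebra, which separates points by the
     Hahn-Banach theorem, so by Stone-Weierstrass they approximate every
     continuous psi : E -> R;
   - splitting y into y^+ - y^-, one gets all psi(e) y, hence, with a partition
     of unity on K, every continuous map E -> F. *)

Require Import Defs.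
From HB Require Import structures.
From mathcomp Require Import all_boot all_order all_algebra.
From mathcomp Require Import all_classical all_reals all_analysis.
From mathcomp Require Import ring lra.

Set Implicit Arguments.
Unset Strict Implicit.
Unset Printing Implicit Defensive.

Import Order.TTheory GRing.Theory Num.Theory.
Import numFieldNormedType.Exports.

Local Open Scope classical_set_scope.
Local Open Scope ring_scope.

(** * Hahn-Banach separation *)

Section sublinear.
Context {R : realType} {E : lmodType R}.
Implicit Types (p q : E -> R) (x y z : E).

(** Homogeneity is only an inequality for [0 < a]; applied to [a^-1] as well, it becomes an
    equality. *)
Definition sublinear p :=
  (forall x y, p (x + y) <= p x + p y) /\
  (forall a x, 0 < a -> p (a *: x) <= a * p x).

Lemma sublinear0 p : sublinear p -> p 0 = 0.
Proof.
move=> [_ pZ]; apply/eqP; rewrite eq_le.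
have := pZ 2 0 ltac:(lra); have := pZ 2^-1 0 ltac:(lra).
by rewrite !scaler0; lra.
Qed.

Lemma sublinearZ p a x : sublinear p -> 0 <= a -> p (a *: x) = a * p x.
Proof.
move=> sp; rewrite le_eqVlt => /orP[/eqP<-|a0].
  by rewrite scale0r mul0r sublinear0.
apply/eqP; rewrite eq_le sp.2//= mulrC -ler_pdivlMr// mulrC.
by rewrite -{1}(scale1r x) -(mulVf (lt0r_neq0 a0)) -scalerA sp.2// invr_gt0.
Qed.

Lemma sublinear_geN p x : sublinear p -> - p (- x) <= p x.
Proof. by move=> sp; have := sp.1 x (- x); rewrite subrr sublinear0//; lra. Qed.

(** Serves for infima along a ray and over a chain. The [f i] need not be subadditive one by one: a
    third index [k] handles the sum. The lower bound [- p (- x)] keeps the infima finite. *)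
Lemma sublinear_inf (I : Type) (D : set I) (f : I -> E -> R) p :
  sublinear p -> D !=set0 ->
  (forall i x, D i -> - p (- x) <= f i x) ->
  (forall i j x y, D i -> D j ->
    exists2 k, D k & f k (x + y) <= f i x + f j y) ->
  (forall i a x, 0 < a -> D i -> exists2 k, D k & f k (a *: x) <= a * f i x) ->
  sublinear (fun x => inf [set f i x | i in D]).
Proof.
move=> sp D0 fp fD fZ.
have lb x i : D i -> inf [set f i x | i in D] <= f i x.
  move=> Di; apply: ge_inf; last by exists i.
  by exists (- p (- x)) => _ [j Dj <-]; exact: fp.
have inf_ge x c : (forall i, D i -> c <= f i x) -> c <= inf [set f i x | i in D].
  move=> cf; apply: lb_le_inf; first exact: image_nonempty.
  by move=> _ [i Di <-]; exact: cf.
split=> [x y|a x a0] /=.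
  rewrite -lerBlDr; apply: (@inf_ge) => i Di; rewrite lerBlDl -lerBlDr.
  apply: (@inf_ge) => j Dj; rewrite lerBlDl.
  by have [k Dk] := fD i j x y Di Dj; apply: le_trans; exact: lb.
rewrite mulrC -ler_pdivrMr//; apply: (@inf_ge) => i Di; rewrite ler_pdivrMr// mulrC.
by have [k Dk] := fZ i a x a0 Di; apply: le_trans; exact: lb.
Qed.

(* Lowers [q] towards [- q x] at [- x]; a minimal [q] is thus odd at [x]. *)
Lemma sublinear_lower q x : sublinear q ->
  exists q', [/\ sublinear q', forall y, q' y <= q y & q' (- x) <= - q x].
Proof.
(* In the infimum of [f t] over [t >= 0], [t = 0] gives [q y], and [t = 1] at [- x] gives
   [- q x]. *)
move=> sq; pose f (t : R) y := q (y + t *: x) - t * q x.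
pose D : set R := [set t | 0 <= t].
have fq t y : D t -> - q (- y) <= f t y.
  move=> t0; rewrite /f -sublinearZ//.
  by have := sq.1 (y + t *: x) (- y); rewrite addrC addKr; lra.
have lb t y : D t -> inf [set f i y | i in D] <= f t y.
  move=> Dt; apply: ge_inf; last by exists t.
  by exists (- q (- y)) => _ [j Dj <-]; exact: fq.
exists (fun y => inf [set f t y | t in D]); split.
- apply: (@sublinear_inf _ _ _ q) => //.
  + by exists 0; rewrite /D/=.
  + move=> s t y z; rewrite /D/= => s0 t0; exists (s + t); first by rewrite addr_ge0.
    by rewrite /f scalerDl addrACA; have := sq.1 (y + s *: x) (z + t *: x); lra.
  + move=> s a y a0; rewrite /D/= => s0; exists (a * s); first by rewrite mulr_ge0// ltW.
    by rewrite /f -scalerA -scalerDr mulrBr mulrA lerB// sq.2.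
- move=> y; rewrite (le_trans (lb 0 y _))//; first by rewrite /D/=.
  by rewrite /f scale0r mul0r addr0 subr0.
- rewrite (le_trans (lb 1 _ _))//; first by rewrite /D/=.
  by rewrite /f scale1r addNr sublinear0// mul1r sub0r.
Qed.

(** Zorn's lemma for the reversed pointwise order: a non-empty chain is bounded by its pointwise
    infimum, finite since every member is at least [- p (- x)] at [x]. *)
Lemma sublinear_minimal p : sublinear p ->
  exists q, [/\ sublinear q, forall x, q x <= p x &
    forall q', sublinear q' -> (forall x, q' x <= q x) -> forall x, q x <= q' x].
Proof.
move=> sp; pose T := {q : E -> R | sublinear q /\ forall x, q x <= p x}.
pose t0 : T := exist _ p (conj sp (fun x => lexx (p x))).
pose ge (q q' : T) := `[< forall x, sval q' x <= sval q x >].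
have [|r s t /asboolP rs /asboolP st|A Atot|] := @ZL_preorder T t0 ge.
- by move=> t; apply/asboolP => x.
- by apply/asboolP => x; rewrite (le_trans (st x)).
- have [A0|] := pselect (A !=set0); last first.
    by move=> A0; exists t0 => s As; case: A0; exists s.
  have Ap (i : T) x : A i -> - p (- x) <= sval i x.
    case: i => q [sq qp] _ /=; apply: le_trans (sublinear_geN x sq).
    by rewrite lerN2.
  have lb (i : T) x : A i -> inf [set sval i x | i in A] <= sval i x.
    move=> Ai; apply: ge_inf; last by exists i.
    by exists (- p (- x)) => _ [j Dj <-]; exact: Ap.
  have si : sublinear (fun x => inf [set sval i x | i in A]).
    apply: (@sublinear_inf _ _ _ p) => //.
    + move=> i j x y Ai Aj.
      have [/asboolP|/asboolP] := Atot i j Ai Aj => ij.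
        by exists j => //; rewrite (le_trans ((svalP j).1.1 _ _))// lerD2r.
      by exists i => //; rewrite (le_trans ((svalP i).1.1 _ _))// lerD2l.
    + by move=> i a x a0 Ai; exists i => //; exact: (svalP i).1.2.
  have ip x : inf [set sval i x | i in A] <= p x.
    case: A0 => i Ai; rewrite (le_trans (lb i x Ai))//; exact: (svalP i).2.
  have sip : sublinear (fun x => inf [set sval i x | i in A]) /\
    forall x, inf [set sval i x | i in A] <= p x by [].
  by exists (exist _ _ sip : T) => s As; apply/asboolP => x; exact: lb.
move=> [q [sq qp]] qmin; exists q; split=> // q' sq' q'q x.
have q'p y : q' y <= p y by exact: le_trans (q'q y) (qp y).
by have /asboolP := qmin (exist _ q' (conj sq' q'p)) ltac:(exact/asboolP); exact.
Qed.

(** Once [p] is lowered to [p'] with [p' (- z) <= - p z], a minimal [q] below [p'] is odd, hence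
    additive and linear. Then [- q z = q (- z) <= p' (- z) <= - p z]. *)
Theorem hahn_banach p z : sublinear p ->
  exists2 T : {scalar E}, forall x, T x <= p x & p z <= T z.
Proof.
move=> sp; have [p' [sp' p'p p'z]] := sublinear_lower z sp.
have [q [sq qp' qmin]] := sublinear_minimal sp'.
have qN x : q (- x) = - q x.
  apply/eqP; rewrite eq_le; apply/andP; split; last first.
    by have := sublinear_geN x sq; lra.
  have [q' [sq' q'q q'x]] := sublinear_lower x sq.
  exact: le_trans (qmin q' sq' q'q _) q'x.
have qD x y : q (x + y) = q x + q y.
  apply/eqP; rewrite eq_le sq.1/=.
  by have := sq.1 (x + y) (- y); rewrite addrK qN; lra.
have q_linear : scalar q.
  move=> a x y; rewrite qD; congr (_ + _).
  have [a0|a0] := leP 0 a; first exact: sublinearZ.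
  by rewrite -{1}[a]opprK scaleNr qN sublinearZ ?oppr_ge0 ?ltW// mulNr opprK.
pose T : {scalar E} :=
  HB.pack q (GRing.isLinear.Build R E R *%R q q_linear).
exists T => [x|]; first exact: le_trans (qp' x) (p'p x).
by have := le_trans (qp' (- z)) p'z; rewrite qN /=; lra.
Qed.

End sublinear.

(** * Gauges and continuous functionals *)

Section separation.
Context {R : realType} {E : tvsType R}.

Lemma nbhs0_absorbing (B : set E) (v : E) : nbhs 0 B ->
  exists2 t : R, 0 < t & B (t^-1 *: v).
Proof.
move=> B0; have /= := scale_continuous (0 : R^o, v) B.
rewrite scale0r => /(_ B0)[]/= [U V] [U0 Vv] UV.
have : \forall k \near (0 : R)^'+, U k.
  by apply: cvg_within; exact: U0.
move=> Unear; near (0 : R)^'+ => k.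
exists k^-1; first by rewrite invr_gt0.
rewrite invrK; apply: (UV (k, v)); split; last exact: nbhs_singleton.
by near: k.
Unshelve. all: by end_near. Qed.

Lemma convex_comb (B : set E) (x y : E) (a b : R) : convex_set B ->
  B x -> B y -> 0 <= a -> 0 <= b -> a + b = 1 -> B (a *: x + b *: y).
Proof.
move=> cB Bx By a0 b0 ab.
have a1 : a <= 1 by lra.
have -> : b = 1 - a by lra.
exact: set_mem (cB x y (Itv01 a0 a1) (mem_set Bx) (mem_set By)).
Qed.

(** The Minkowski functional of [B]. It is subadditive because [(t + s)^-1 *: (x + y)] is a convex
    combination of [s^-1 *: x] and [t^-1 *: y]. As [B] contains 0, it contains [t *: b] for [b] in
    [B] and [0 < t < 1], which gives the last clause. *)
Lemma gauge_sublinear (B : set E) : nbhs 0 B -> convex_set B ->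
  exists p, [/\ sublinear p, forall x : E, B x -> p x <= 1 &
    forall x, ~ B x -> 1 <= p x].
Proof.
move=> B0 cB; pose G x := [set t : R | 0 < t /\ B (t^-1 *: x)].
have G0 x : G x !=set0 by have [t t0 Bt] := nbhs0_absorbing x B0; exists t.
have lb x t : G x t -> inf (G x) <= t.
  by move=> Gt; apply: ge_inf => //; exists 0 => s [/ltW].
exists (fun x => inf (G x)); split=> [|x Bx|x nBx].
- split=> [x y|a x a0] /=.
    rewrite -lerBlDr; apply: lb_le_inf => // s [s0 Bs].
    rewrite lerBlDl -lerBlDr; apply: lb_le_inf => // t [t0 Bt].
    rewrite lerBlDr; apply: lb; split; first by rewrite addr_gt0.
    have st0 : t + s != 0 by rewrite gt_eqF// addr_gt0.
    have -> : (t + s)^-1 *: (x + y) =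
        (s / (t + s)) *: (s^-1 *: x) + (t / (t + s)) *: (t^-1 *: y).
      rewrite !scalerA scalerDr; congr (_ *: _ + _ *: _); field.
        by rewrite st0 gt_eqF.
      by rewrite st0 gt_eqF.
    apply: convex_comb => //; rewrite ?divr_ge0 ?addr_ge0// ?ltW//.
    by field.
  rewrite mulrC -ler_pdivrMr//; apply: lb_le_inf => // s [s0 Bs].
  rewrite ler_pdivrMr//; apply: lb; split; first by rewrite mulr_gt0.
  by rewrite scalerA invfM mulfVK ?gt_eqF.
- by apply: lb; split=> //; rewrite invr1 scale1r.
- apply: lb_le_inf => // t [t0 Bt]; rewrite leNgt; apply/negP => t1; apply: nBx.
  have -> : x = t *: (t^-1 *: x) + (1 - t) *: 0.
    by rewrite scaler0 addr0 scalerA divff ?gt_eqF// scale1r.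
  by apply: convex_comb => //; [exact: nbhs_singleton|lra|lra|lra].
Qed.

(** The bound on [U] becomes two-sided on the intersection of [U] and [- U], and scales by
    homogeneity. *)
Lemma scalar_continuous (T : {scalar E}) (U : set E) : nbhs 0 U ->
  (forall x, U x -> T x <= 1) -> continuous T.
Proof.
move=> U0 TU x; apply/cvgrPdist_le => e e0.
pose V := U `&` (-%R @` U).
have V0 : nbhs 0 V by apply: filterI => //; exact: nbhs0N.
have TV v : V v -> `|T v| <= 1.
  move=> [Uv [w Uw wv]]; rewrite ler_norml TU// andbT.
  by rewrite -wv raddfN lerN2 TU.
have := nbhsT x (nbhs0Z (lt0r_neq0 e0) V0); apply: filterS => _ [_ [v Vv <-] <-].
rewrite raddfD opprD addNKr normrN [X in `|X|](_ : _ = e * T v); last first.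
  exact: linearZ.
rewrite normrM gtr0_norm//.
by rewrite ger_pMr// TV.
Qed.

(** Some convex open [B] around 0 misses [x - y]. With [p] its gauge, Hahn-Banach gives [T <= p] and
    [1 <= p (x - y) <= T (x - y)]; [T] is continuous since [T <= 1] on [B]. *)
Theorem dual_separates_points (x y : E) : hausdorff_space E -> x != y ->
  exists2 T : {scalar E}, continuous T & T x != T y.
Proof.
move=> hE xy.
have [U U0 nUz] : exists2 U : set E, nbhs 0 U & ~ U (x - y).
  have /eqP z0 : x - y != 0 by rewrite subr_eq0.
  apply: contrapT => h; apply: z0; apply: hE => A C zA C0.
  exists (x - y); split; first exact: nbhs_singleton.
  by apply: contrapT => nC; apply: h; exists C.
have [Bs cvxB [openB baseB]] := @locally_convex R E.
have [B [BsB B0] BU] := baseB 0 U U0.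
have B0' : nbhs 0 B by apply: open_nbhs_nbhs; split=> //; exact: openB.
have [p [sp pB pnB]] := gauge_sublinear B0' (cvxB _ (mem_set BsB)).
have [T Tp Tz] := hahn_banach (x - y) sp.
exists T.
  by apply: (scalar_continuous B0') => v /pB; exact: le_trans.
have : 1 <= T (x - y) by apply: le_trans Tz; apply: pnB => /BU.
by rewrite raddfB -subr_eq0 => ?; rewrite gt_eqF//; lra.
Qed.

End separation.

(** * Uniform approximation and the Stone-Weierstrass theorem *)

Section uniform_approximation.
Context {R : realType} {T : Type} {V : normedModType R}.
Implicit Types (K : set T) (S : set (T -> V)).

Definition lin_closed S := S (fun=> 0) /\
  forall a f g, S f -> S g -> S (fun x => a *: f x + g x).

(** The closure of [S] for uniform convergence on [K]. *)
Definition uapprox K S : set (T -> V) := [set f | forall e : R, 0 < e ->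
  exists2 g, S g & forall x, K x -> `|f x - g x| <= e].

Lemma lin_closedD S f g : lin_closed S -> S f -> S g ->
  S (fun x => f x + g x).
Proof.
move=> [_ Slin] Sf Sg; rewrite (_ : (fun x => _) = fun x => 1 *: f x + g x).
  exact: Slin.
by apply/funext => x; rewrite scale1r.
Qed.

Lemma lin_closedZ S a f : lin_closed S -> S f -> S (fun x => a *: f x).
Proof.
move=> [S0 Slin] Sf; rewrite (_ : (fun x => _) = fun x => a *: f x + 0).
  exact: Slin.
by apply/funext => x; rewrite addr0.
Qed.

Lemma lin_closedB S f g : lin_closed S -> S f -> S g ->
  S (fun x => f x - g x).
Proof.
move=> [_ Slin] Sf Sg; rewrite (_ : (fun x => _) = fun x => -1 *: g x + f x).
  exact: Slin.
by apply/funext => x; rewrite scaleN1r addrC.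
Qed.

Lemma sub_uapprox K S : S `<=` uapprox K S.
Proof.
by move=> f Sf e e0; exists f => // x _; rewrite subrr normr0 ltW.
Qed.

Lemma uapprox_trans K S S' : S `<=` uapprox K S' ->
  uapprox K S `<=` uapprox K S'.
Proof.
move=> SS' f Sf e e0; have e20 : 0 < e / 2 by lra.
have [g Sg fg] := Sf _ e20; have [h Sh gh] := SS' _ Sg _ e20.
exists h => // x Kx; rewrite (le_trans (ler_distD (g x) _ _))//.
by rewrite [e]splitr lerD ?fg ?gh.
Qed.

Lemma uapprox_lin K S : lin_closed S -> lin_closed (uapprox K S).
Proof.
move=> [S0 Slin]; split=> [|a f g Sf Sg e e0]; first exact: sub_uapprox.
(* The added 1 allows division when [a = 0]. *)
have a0 : 0 < `|a| + 1 by rewrite ltr_wpDl.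
have [f' Sf' ff'] := Sf (e / (2 * (`|a| + 1))) ltac:(by rewrite divr_gt0 ?mulr_gt0).
have [g' Sg' gg'] := Sg (e / 2) ltac:(lra).
exists (fun x => a *: f' x + g' x) => [|x Kx]; first exact: Slin.
rewrite opprD addrACA -scalerBr (le_trans (ler_normD _ _))//.
rewrite normrZ [e]splitr lerD ?gg'//.
rewrite (@le_trans _ _ (`|a| * (e / (2 * (`|a| + 1)))))// ?ler_wpM2l ?ff'//.
rewrite mulrA ler_pdivrMr ?mulr_gt0//.
have -> : e / 2 * (2 * (`|a| + 1)) = `|a| * e + e by field.
lra.
Qed.

End uniform_approximation.

(** Compactness as induction on finite unions. If [P K] failed, the sets [W] such that [P] holds of
    [K] minus [W] would form a proper filter containing [K]; but a cluster point has a neighbourhood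
    [U] with [P U], whose complement lies in the filter. *)
Lemma compact_ind (T : topologicalType) (K : set T) (P : set T -> Prop) :
  compact K -> P set0 -> (forall A B, P A -> P B -> P (A `|` B)) ->
  (forall A B, A `<=` B -> P B -> P A) ->
  (forall x, K x -> exists2 U, nbhs x U & P U) -> P K.
Proof.
move=> cK P0 PU Psub Ploc; apply: contrapT => nPK.
pose F : set_system T := [set W | P (K `\` W)].
have PF : ProperFilter F.
  split; first by rewrite /F/= setD0.
  split; first by rewrite /F/= setDT.
    by move=> A B FA FB; rewrite /F/= setDIr; exact: PU.
  by move=> A B AB; rewrite /F/=; apply: Psub; exact: setDS.
have [x [Kx xF]] := cK F PF ltac:(by rewrite /F/= setDv).
have [U Ux PUx] := Ploc x Kx.
have [y [/= nUy Uy]] := xF (~` U) U ltac:(by apply: Psub PUx => y [_ /contrapT]) Ux.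
exact: nUy.
Qed.

Lemma compact_norm_bounded {R : realType} (T : topologicalType) (K : set T)
    (f : T -> R^o) : compact K -> continuous f ->
  exists2 M, 1 <= M & forall x, K x -> `|f x| <= M.
Proof.
move=> cK cf.
pose P (A : set T) := exists2 M : R, 1 <= M & forall x, A x -> `|f x| <= M.
apply: (compact_ind (P := P)) => //.
- by exists 1.
- move=> A B [M M1 fM] [N N1 fN]; exists (M + N); first lra.
  by move=> x [/fM|/fN]; lra.
- by move=> A B AB [M M1 fM]; exists M => // x /AB/fM.
- move=> x Kx; exists [set y | `|f x - f y| < 1].
    have /cvgrPdist_lt := cf x; exact.
  exists (`|f x| + 1); first by rewrite lerDr.
  move=> y /= xy; rewrite -(subKr (f x) (f y)) (le_trans (ler_normB _ _))//.
  by rewrite lerD2l ltW.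
Qed.

(* Iterating [p |-> p + (t ^+ 2 - p ^+ 2) / 2] from 0 converges to [`|t|],
   uniformly on the unit interval. *)
Fixpoint abs_iter {R : realType} (n : nat) (t : R) : R :=
  if n is n'.+1 then
    abs_iter n' t + 2^-1 * (t * t - abs_iter n' t * abs_iter n' t)
  else 0.

(** The error [d = |t| - p] becomes [d * (1 - (|t| + p) / 2) <= d * (1 - d / 2)], as [p >= 0]. If
    [d * N <= 2], then [d * (1 - d / 2) * (N + 1) <= (d + 2) * (1 - d / 2) <= 2]. *)
Lemma abs_iter_bound {R : realType} (n : nat) (t : R) : `|t| <= 1 ->
  0 <= abs_iter n t <= `|t| /\ (`|t| - abs_iter n t) * n.+1%:R <= 2.
Proof.
move=> t1; have t0 := normr_ge0 t.
have tt : t * t = `|t| * `|t| by rewrite -normrM ger0_norm// -expr2 sqr_ge0.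
elim: n => [|n [/andP[p0 pt] ptn]]; first by rewrite /= lexx t0 subr0 mulr1; lra.
rewrite /= tt; move: (abs_iter n t) p0 pt ptn => p p0 pt ptn.
have N0 : 0 <= n.+1%:R :> R by [].
rewrite -[n.+2]addn1 natrD; move: (n.+1%:R : R) N0 ptn => N N0 ptn.
split; first by apply/andP; split; nra.
set d := `|t| - p in ptn.
have d0 : 0 <= d by rewrite subr_ge0.
have -> : `|t| - (p + 2^-1 * (`|t| * `|t| - p * p)) =
  d * (1 - (`|t| + p) / 2) by rewrite /d; field.
have : d * (1 - (`|t| + p) / 2) <= d * (1 - d / 2).
  by rewrite ler_wpM2l// /d; lra.
have d1 : d <= 1 by rewrite /d; lra.
move=> h; apply: le_trans (_ : d * (1 - d / 2) * (N + 1) <= _).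
  by rewrite ler_wpM2r// addr_ge0.
have : 0 <= (2 - d * N) * (1 - d / 2) by rewrite mulr_ge0//; lra.
nra.
Qed.

Section stone_weierstrass.
Context {R : realType} {E : topologicalType} (K : set E) (A : set (E -> R^o)).
Context (cK : compact K) (ctsA : forall f, A f -> continuous f).
Context (linA : lin_closed A) (A1 : A (fun=> 1)).
Context (mulA : forall f g, A f -> A g -> A (fun x => f x * g x)).
Context
  (sepA : forall x y, K x -> K y -> x != y -> exists2 f, A f & f x != f y).

(** Passing to the closure of [A] gives stability under absolute values, hence under [max] and
    [min]; continuity is kept for the compactness arguments. *)
Let L := [set f : E -> R^o | continuous f /\ uapprox K A f].

Let subL : A `<=` L.
Proof. by move=> f Af; split; [exact: ctsA|exact: sub_uapprox]. Qed.

Let linL : lin_closed L.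
Proof.
have [_ lin] := uapprox_lin K linA.
split=> [|a f g [cf Lf] [cg Lg]]; first by apply: subL; exact: linA.1.
split; last exact: lin.
by move=> x; apply: cvgD; [apply: cvgZl_tmp; exact: cf|exact: cg].
Qed.

Let cstL (c : R) : L (fun=> c).
Proof.
have := lin_closedZ c linL (subL A1).
by congr (L _); apply/funext => x; rewrite /GRing.scale/= mulr1.
Qed.

Let mulL f g : L f -> L g -> L (fun x => f x * g x).
Proof.
move=> [cf Lf] [cg Lg]; split.
  by move=> x; apply: cvgM; [exact: cf|exact: cg].
move=> e e0.
have [M M1 fM] := compact_norm_bounded cK cf.
have [N N1 gN] := compact_norm_bounded cK cg.
(* The error of the product is at most [M * d + d * N + d * d], hence at most [d * (M + N + 1)] as
   [d <= 1]. *)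
pose d := Num.min 1 (e / (M + N + 1)).
have d0 : 0 < d by rewrite lt_min ltr01 divr_gt0//; lra.
have d1 : d <= 1 by rewrite ge_min lexx.
have de : d * (M + N + 1) <= e by rewrite -ler_pdivlMr ?ge_min ?lexx ?orbT//; lra.
have [f' Af' ff'] := Lf d d0; have [g' Ag' gg'] := Lg d d0.
exists (fun x => f' x * g' x) => [|x Kx]; first exact: mulA.
have -> : f x * g x - f' x * g' x =
  f x * (g x - g' x) + (f x - f' x) * g x - (f x - f' x) * (g x - g' x) by ring.
rewrite (le_trans (ler_normB _ _))//.
rewrite (@le_trans _ _ (M * d + d * N + d * d))//; last by nra.
rewrite lerD// ?normrM ?ler_pM ?ff' ?gg'//.
by rewrite (le_trans (ler_normD _ _))// lerD// normrM ler_pM ?ff' ?gg' ?fM ?gN.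
Qed.

Let absL f : L f -> L (fun x => `|f x|).
Proof.
move=> [cf Lf]; split; first by move=> x; apply: cvg_norm; exact: cf.
have [M M1 fM] := compact_norm_bounded cK cf.
have M0 : 0 < M by lra.
pose h x : R^o := M^-1 * f x.
have Lh : L h by exact: (lin_closedZ M^-1 linL).
have iterL n : L (fun x => abs_iter n (h x)).
  elim: n => [|n IHn]; first exact: cstL.
  apply: (lin_closedD linL IHn); apply: (lin_closedZ 2^-1 linL).
  by apply: (lin_closedB linL); exact: mulL.
suff Kh : uapprox K A (fun x => `|h x|).
  have := lin_closedZ M (uapprox_lin K linA) Kh.
  congr (uapprox _ _ _); apply/funext => x.
  by rewrite /h normrM gtr0_norm ?invr_gt0// /GRing.scale/= mulrA divff ?mul1r ?gt_eqF.
apply: (@uapprox_trans _ _ _ K L) => [g []//|e e0].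
pose n := Num.bound (2 / e).
have ne : 2 <= e * n.+1%:R.
  have := archi_boundP (ltac:(by rewrite divr_ge0 ?ltW) : 0 <= 2 / e).
  rewrite -/n ltr_pdivrMr// mulrC => /ltW/le_trans; apply.
  by rewrite ler_wpM2l ?ler_nat// ltW.
exists (fun x => abs_iter n (h x)) => // x Kx.
have h1 : `|h x| <= 1.
  by rewrite /h normrM gtr0_norm ?invr_gt0// mulrC ler_pdivrMr// mul1r fM.
have [/andP[_ nh] hn] := abs_iter_bound n h1.
rewrite ger0_norm ?subr_ge0// -(@ler_pM2r _ n.+1%:R) ?ltr0Sn//.
exact: le_trans hn ne.
Qed.

(** The maximum of [f] and [g] for [c = 1], their minimum for [c = -1]. *)
Let half_maxL (c : R) f g : L f -> L g ->
  L (fun x => 2^-1 * (f x + g x + c * `|f x - g x|)).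
Proof.
move=> Lf Lg; apply: (lin_closedZ 2^-1 linL).
apply: (lin_closedD linL); first exact: lin_closedD.
by apply: (lin_closedZ c linL); apply: absL; exact: lin_closedB.
Qed.

Let maxL f g : L f -> L g -> L (fun x => Num.max (f x) (g x)).
Proof.
move=> Lf Lg; have := half_maxL 1 Lf Lg.
by congr (L _); apply/funext => x; rewrite maxr_absE mul1r mulrC.
Qed.

Let minL f g : L f -> L g -> L (fun x => Num.min (f x) (g x)).
Proof.
move=> Lf Lg; have := half_maxL (-1) Lf Lg.
by congr (L _); apply/funext => x; rewrite minr_absE mulN1r mulrC.
Qed.

Let interpolation (h : E -> R^o) x y : K x -> K y ->
  exists g, [/\ L g, g x = h x & g y = h y].
Proof.
move=> Kx Ky; have [->|xy] := eqVneq x y; first by exists (fun=> h y).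
have [f Af fxy] := sepA Kx Ky xy.
have fxy0 : f x - f y != 0 by rewrite subr_eq0.
exists (fun z => (h x - h y) / (f x - f y) * (f z - f y) + h y); split.
- apply: (lin_closedD linL); last exact: cstL.
  apply: (lin_closedZ _ linL); apply: (lin_closedB linL); last exact: cstL.
  exact: subL.
- by field.
- by rewrite subrr mulr0 add0r.
Qed.

(** Compactness is used twice. For fixed [x], a finite maximum of interpolants at [x] and [y] is
    above [h - e2] on [K] and equals [h] at [x]; a finite minimum of such maxima is also below
    [h + e2]. The other half of [e] serves to pass from [L] to [A]. *)
Theorem stone_weierstrass (h : E -> R^o) : continuous h -> uapprox K A h.
Proof.
move=> ch e e0.
have near_gt (u v : E -> R^o) x : continuous u -> continuous v ->
    u x < v x -> nbhs x [set y | u y < v y].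
  move=> cu cv uv.
  have uv0 : 0 < v x - u x by rewrite subr_gt0.
  have /cvgrPdist_lt/(_ _ uv0) : (fun y => v y - u y) @ x --> v x - u x.
    by apply: cvgB; [exact: cv|exact: cu].
  apply: filterS => y; rewrite /= ltr_norml; lra.
pose e2 := e / 2; have e20 : 0 < e2 by rewrite /e2; lra.
have above x : K x -> exists g,
    [/\ L g, g x = h x & forall y, K y -> h y - e2 < g y].
  move=> Kx.
  pose P (U : set E) := exists g,
    [/\ L g, g x = h x & forall y, U y -> h y - e2 < g y].
  apply: (compact_ind (P := P)) => //.
  - by exists (fun=> h x); split.
  - move=> U W [f [Lf fx hf]] [g [Lg gx hg]].
    exists (fun z => Num.max (f z) (g z)); split; first exact: maxL.
      by rewrite fx gx maxxx.
    by move=> y [/hf|/hg]; rewrite lt_max => ->; rewrite ?orbT.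
  - by move=> U W UW [g [Lg gx hg]]; exists g; split=> // y /UW/hg.
  - move=> y Ky; have [g [Lg gx gy]] := interpolation h Kx Ky.
    exists [set z | h z - e2 < g z]; last by exists g.
    apply: near_gt; [|exact: Lg.1|lra].
    by move=> z; apply: cvgB; [exact: ch|exact: cvg_cst].
have [g [[cg Lg] hg gh]] : exists g, [/\ L g, forall y, K y -> h y - e2 < g y &
    forall y, K y -> g y < h y + e2].
  (* The base case needs a point of [K]: even for the empty set, [g] must be above [h - e2] on all
     of [K]. *)
  have [[x0 Kx0]|K0] := pselect (K !=set0); last first.
    by exists (fun=> 0); split=> // y Ky; case: K0; exists y.
  pose P (U : set E) := exists g, [/\ L g, forall y, K y -> h y - e2 < g y &
    forall y, U y -> g y < h y + e2].
  apply: (compact_ind (P := P)) => //.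
  - by have [g [Lg _ hg]] := above x0 Kx0; exists g.
  - move=> U W [f [Lf hf fh]] [g [Lg hg gh]].
    exists (fun z => Num.min (f z) (g z)); split; first exact: minL.
      by move=> y Ky; rewrite lt_min hf// hg.
    by move=> y [/fh|/gh]; rewrite gt_min => ->; rewrite ?orbT.
  - by move=> U W UW [g [Lg hg gh]]; exists g; split=> // y /UW/gh.
  - move=> x Kx; have [g [Lg gx hg]] := above x Kx.
    exists [set z | g z < h z + e2]; last by exists g.
    apply: near_gt; [exact: Lg.1| |lra].
    by move=> z; apply: cvgD; [exact: ch|exact: cvg_cst].
have [f Af gf] := Lg e2 e20.
exists f => // x Kx; rewrite (le_trans (ler_distD (g x) _ _))//.
rewrite [e]splitr lerD ?gf// ltW// distrC ltr_distl.
by rewrite hg// gh.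
Qed.

End stone_weierstrass.

(** * Approximation by absolute values of affine functionals *)

Section exponential_approximation.
Context {R : realType} (Q : set (R -> R^o)) (linQ : lin_closed Q).
Context (Q1 : Q (fun=> 1)) (Qabs : forall c, Q (fun t => `|t - c|)).

Let cstQ (c : R) : Q (fun=> c).
Proof.
have := lin_closedZ c linQ Q1.
by congr (Q _); apply/funext => x; rewrite /GRing.scale/= mulr1.
Qed.

(* The piecewise affine interpolant of [f] at the nodes [a + k * d], [k <= n],
   as a sum of ramps, each a difference of two absolute values. *)
Lemma piecewise_affine_approx (f : R -> R) (a d e : R) (n : nat) :
  {homo f : s t / s <= t} -> 0 < d -> 0 <= e ->
  (forall k, (k < n)%N -> f (a + k.+1%:R * d) - f (a + k%:R * d) <= e) ->
  exists q, [/\ Q q, forall t, a <= t <= a + n%:R * d -> `|f t - q t| <= e &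
    forall t, a + n%:R * d <= t -> q t = f (a + n%:R * d)].
Proof.
move=> homof d0 e0; elim: n => [_|n IHn fe].
  exists (fun=> f a); split=> [//|t|t _]; rewrite !mul0r ?addr0//.
  by rewrite -eq_le => /eqP ->; rewrite subrr normr0.
have {IHn} [|q [Qq fq qf]] := IHn; first by move=> k kn; apply: fe; exact: ltnW.
have {fe} := fe n (ltnSn n).
have nS : a + n.+1%:R * d = a + n%:R * d + d by rewrite -natr1; ring.
have : a <= a + n%:R * d by rewrite lerDl mulr_ge0// ltW.
rewrite nS; move: (a + n%:R * d) fq qf => b fq qf ab; set D := f (b + d) - f b => De.
have D0 : 0 <= D by rewrite subr_ge0 homof// lerDl ltW.
(* The added ramp is 0 up to [b], affine on [[b, b + d]] and [D] afterwards; beyond [b], the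
   previous [q] is constantly [f b]. *)
exists (fun t => q t + (D / (2 * d)) * (`|t - b| - `|t - (b + d)| + d)).
have d2 : d != 0 by rewrite gt_eqF.
split=> [|t /andP[at_ tb]|t bt].
- apply: (lin_closedD linQ Qq); apply: (lin_closedZ (D / (2 * d)) linQ).
  by apply: (lin_closedD linQ); [exact: (lin_closedB linQ)|exact: cstQ].
- rewrite [X in `|_ - X|](_ : _ =
    q t + D * ((`|t - b| - `|t - (b + d)| + d) / (2 * d))); last first.
    by rewrite mulrA [in RHS]mulrAC.
  have -> : `|t - (b + d)| = b + d - t by rewrite ler0_norm; lra.
  have [tb'|bt] := leP t b.
    rewrite [`|t - b|]ler0_norm; last lra.
    rewrite (_ : - (t - b) - _ + d = 0); last ring.
    by rewrite mul0r mulr0 addr0 fq// at_.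
  rewrite [`|t - b|]gtr0_norm ?subr_gt0// (qf _ (ltW bt)).
  rewrite (_ : (t - b - _ + d) / (2 * d) = (t - b) / d); last by field.
  have u0 : 0 <= (t - b) / d by rewrite divr_ge0//; lra.
  have u1 : (t - b) / d <= 1 by rewrite ler_pdivrMr//; lra.
  (* Between the nodes, [f t - f b] and the ramp both lie in [[0, D]], and [D <= e]. *)
  have fbt : f b <= f t by rewrite homof// ltW.
  have ftb : f t - f b <= D by rewrite lerD2r homof.
  have Du0 : 0 <= D * ((t - b) / d) by rewrite mulr_ge0.
  have Du1 : D * ((t - b) / d) <= D by rewrite ler_piMr.
  by rewrite ler_norml; apply/andP; split; lra.
- rewrite qf; last lra.
  rewrite ger0_norm; last lra.
  rewrite ger0_norm; last lra.
  by rewrite /D; field.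
Qed.

(** For [0 < M], cut [[- M, M]] into [n] steps of length [d = 2 * M / n]. An increment
    [expR s - expR (s - d)] is [expR s * (1 - expR (- d)) <= expR M * d], and [n] makes this at most
    [e]. *)
Lemma expR_uapprox (M : R) : uapprox [set t : R | `|t| <= M] Q expR.
Proof.
move=> e e0; have [M0|M0] := leP M 0.
  exists (fun=> expR 0); first exact: cstQ.
  move=> t /= /le_trans/(_ M0); rewrite normr_le0 => /eqP ->.
  by rewrite subrr normr0 ltW.
pose n := (Num.bound (expR M * (2 * M) / e)).
have ne : expR M * (2 * M) <= e * n%:R.
  rewrite -ler_pdivrMl// mulrC; apply/ltW; apply: archi_boundP.
  by rewrite divr_ge0 ?mulr_ge0 ?expR_ge0// ltW.
have n0 : 0 < n%:R :> R.
  rewrite -(pmulr_rgt0 _ e0); apply: lt_le_trans ne.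
  by rewrite !mulr_gt0 ?expR_gt0.
pose d := 2 * M / n%:R; have d0 : 0 < d by rewrite divr_gt0 ?mulr_gt0.
have nd : n%:R * d = 2 * M by rewrite /d mulrC divfK ?gt_eqF.
have expR_homo : {homo expR : s t / s <= t :> R} by move=> s t; rewrite ler_expR.
have [k kn|q [Qq eq _]] :=
    @piecewise_affine_approx expR (- M) d e n expR_homo d0 (ltW e0) _.
- have -> : - M + k%:R * d = - M + k.+1%:R * d - d by rewrite -natr1; ring.
  have kM : - M + k.+1%:R * d <= M.
    have : k.+1%:R * d <= n%:R * d by rewrite ler_pM2r// ler_nat.
    lra.
  move: (- M + k.+1%:R * d) kM => s sM.
  rewrite expRD -[X in X - _]mulr1 -mulrBr.
  have de : expR M * d <= e.
    by rewrite /d mulrA ler_pdivrMr.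
  apply: le_trans de; rewrite ler_pM ?expR_ge0 ?ler_expR//.
    by rewrite subr_ge0 -[leRHS]expR0 ler_expR; lra.
  by have := expR_ge1Dx (- d); lra.
- exists q => // t /= tM; apply: eq; rewrite nd.
  by move: tM; rewrite ler_norml => /andP[? ?]; apply/andP; split; lra.
Qed.

End exponential_approximation.

(** * Exponentials of continuous functionals *)

Section scalar_density.
Context {R : realType} {E : tvsType R}.

(** Built one term at a time, so that stability under sums and products goes by induction. *)
Inductive exp_sum : (E -> R^o) -> Prop :=
| exp_sum0 : exp_sum (fun=> 0)
| exp_sumD (c : R) (T : {scalar E}) g : continuous T -> exp_sum g ->
    exp_sum (fun x => c * expR (T x) + g x).

Lemma exp_sum_lin : lin_closed exp_sum.
Proof.
split; first exact: exp_sum0.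
move=> a f g; elim=> {f} [|c T f cT _ IHf] sg.
  by move: sg; congr exp_sum; apply/funext => x; rewrite scaler0 add0r.
have := exp_sumD (a * c) cT (IHf sg).
by congr exp_sum; apply/funext => x; rewrite scalerDr addrA /GRing.scale/= mulrA.
Qed.

Lemma exp_sumM f g : exp_sum f -> exp_sum g -> exp_sum (fun x => f x * g x).
Proof.
move=> + sg; elim=> {f} [|c T f cT _ IHf].
  have := exp_sum0; congr exp_sum; apply/funext => x.
  by rewrite mul0r.
have h : exp_sum (fun x => c * expR (T x) * g x).
  elim: sg => {g IHf} [|b U g cU _ IHg].
    have := exp_sum0; congr exp_sum; apply/funext => x.
    by rewrite mulr0.
  have cTU : continuous (T \+ U) by move=> x; apply: cvgD; [exact: cT|exact: cU].
  have := @exp_sumD (c * b) (T \+ U) _ cTU IHg.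
  congr exp_sum; apply/funext => x /=.
  by rewrite expRD; ring.
have := lin_closedD exp_sum_lin h IHf.
congr exp_sum; apply/funext => x /=.
by rewrite mulrDl.
Qed.

Lemma exp_sum_expR (T : {scalar E}) : continuous T ->
  exp_sum (fun x => expR (T x)).
Proof.
move=> cT; have := exp_sumD 1 cT exp_sum0.
by congr exp_sum; apply/funext => x; rewrite mul1r addr0.
Qed.

Lemma exp_sum_continuous f : exp_sum f -> continuous f.
Proof.
elim=> {f} [|c T f cT _ cf] x; first exact: cvg_cst.
apply: cvgD; last exact: cf.
apply: (@cvgZl_tmp _ R^o); apply: continuous_comp; first exact: cT.
exact: continuous_expR.
Qed.

Lemma cst0_continuous : continuous (\0 : {scalar E}).
Proof. by move=> x; exact: cvg_cst. Qed.

Theorem abs_affine_uapprox (S : set (E -> R^o)) (K : set E) (h : E -> R^o) :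
  hausdorff_space E -> compact K -> lin_closed S ->
  (forall T : {scalar E}, continuous T -> forall c, S (fun x => `|T x - c|)) ->
  continuous h -> uapprox K S h.
Proof.
move=> hE cK linS absS ch.
suff exp_sumS : exp_sum `<=` uapprox K S.
  apply: (uapprox_trans exp_sumS).
  apply: stone_weierstrass => //.
  - exact: exp_sum_continuous.
  - exact: exp_sum_lin.
  - have := exp_sum_expR cst0_continuous.
    by congr exp_sum; apply/funext => x; rewrite /= expR0.
  - exact: exp_sumM.
  - move=> x y _ _ xy; have [T cT Txy] := dual_separates_points hE xy.
    exists (fun x => expR (T x)); first exact: exp_sum_expR.
    by apply: contra_neq Txy => /expR_inj.
move=> f; elim=> {f} [|c T f cT _ Sf].
  by apply: sub_uapprox; exact: linS.1.
apply: (lin_closedD (uapprox_lin K linS)) => //.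
apply: (lin_closedZ c (uapprox_lin K linS)).
have [M M1 TM] := compact_norm_bounded cK cT.
(* Pulling [S] back along [T] reduces the claim to approximating [expR] on [[- M, M]]. *)
pose Q : set (R -> R^o) := [set q | S (fun x => q (T x))].
have linQ : lin_closed Q.
  by split=> [|a p q]; [exact: linS.1|exact: linS.2].
have Q1 : Q (fun=> 1).
  (* The constant 1 is [|T x - c|] for [T = 0] and [c = 1]. *)
  have := absS \0 cst0_continuous 1.
  by congr S; apply/funext => x /=; rewrite sub0r normrN normr1.
have Qabs c' : Q (fun t => `|t - c'|) by exact: absS.
move=> e e0; have [q Qq qe] := expR_uapprox linQ Q1 Qabs M e0.
by exists (fun x => q (T x)) => // x Kx; apply: qe => /=; exact: TM.
Qed.

End scalar_density.

(** * Vector-valued functions *)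

(* If [G] approximates [rho f] within [e rho] for a positive weight [rho], then
   [G / rho] approximates [f] within [e]; unlike the partitions of unity that
   they encode, such pairs [(rho, G)] can be added. *)
Lemma tensor_uapprox {R : realType} (E : topologicalType) (F : normedModType R)
    (K : set E) (W : set (E -> F)) (f : E -> F) :
  compact K -> lin_closed W ->
  (forall (psi : E -> R^o) y, continuous psi -> W (fun x => psi x *: y)) ->
  continuous f -> uapprox K W f.
Proof.
move=> cK linW Wpsi cf e e0.
(* Every continuous multiple of [G] must be in [W], so that one can divide by [rho] at the end. *)
pose P (U : set E) := exists (rho : E -> R^o) (G : E -> F),
  [/\ continuous rho, forall x, 0 <= rho x /\ (U x -> 0 < rho x),
      forall psi : E -> R^o, continuous psi -> W (fun x => psi x *: G x) &
      forall x, `|rho x *: f x - G x| <= e * rho x].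
have [rho [G [crho rho0 WG fG]]] : P K.
  apply: compact_ind => //.
  - exists (fun=> 0), (fun=> 0); split=> // [x|psi cpsi|x].
    + exact: cvg_cst.
    + exact: Wpsi.
    + by rewrite scale0r subr0 normr0 mulr0.
  - move=> U V [a [G [ca a0 WG aG]]] [b [H [cb b0 WH bH]]].
    exists (fun x => a x + b x), (fun x => G x + H x); split=> [x|x|psi cpsi|x].
    + by apply: cvgD; [exact: ca|exact: cb].
    + have [a0x aU] := a0 x; have [b0x bV] := b0 x.
      split; first exact: addr_ge0.
      by move=> [/aU|/bV] ?; [exact: ltr_wpDr|exact: ltr_wpDl].
    + have := lin_closedD linW (WG _ cpsi) (WH _ cpsi).
      by congr W; apply/funext => x; rewrite scalerDr.
    + rewrite scalerDl opprD addrACA (le_trans (ler_normD _ _))//.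
      by rewrite mulrDr lerD.
  - move=> U V UV [rho [G [crho rho0 WG fG]]]; exists rho, G; split=> // x.
    by have [? h] := rho0 x; split=> // /UV.
  - move=> x Kx; exists [set z | `|f x - f z| < e].
      by have /cvgrPdist_lt := cf x; exact.
    (* This weight vanishes where [f] is at least [e] away from [f x], so [rho z *: f x] is within
       [e * rho z] of [rho z *: f z] everywhere. *)
    pose rho z : R^o := Num.max 0 (e - `|f x - f z|).
    have crho : continuous rho.
      move=> z; apply: (@continuous_max R E (fun=> 0)); first exact: cvg_cst.
      apply: cvgB; first exact: cvg_cst.
      by apply: cvg_norm; apply: cvgB; [exact: cvg_cst|exact: cf].
    exists rho, (fun z => rho z *: f x); split=> // [z|psi cpsi|z].
    + by rewrite /rho le_max lexx lt_max subr_gt0; split=> //= ->; rewrite orbT.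
    + have := Wpsi (fun z => psi z * rho z) (f x) _.
      rewrite (_ : (fun z => _ *: (rho z *: _)) = fun z => (psi z * rho z) *: f x).
        by apply=> z; apply: cvgM; [exact: cpsi|exact: crho].
      by apply/funext => z; rewrite scalerA.
    + have rho0 : 0 <= rho z by rewrite /rho le_max lexx.
      rewrite -scalerBr normrZ (ger0_norm rho0) mulrC.
      have [fe|ef] := leP `|f x - f z| e; first by rewrite ler_wpM2r// distrC.
      by rewrite (_ : rho z = 0) ?mulr0//; apply/max_idPl; rewrite subr_le0 ltW.
have [d d0 rhod] : exists2 d : R, 0 < d & forall x, K x -> d <= rho x.
  pose B (U : set E) := exists2 d : R, 0 < d & forall x, U x -> d <= rho x.
  apply: (compact_ind (P := B)) => //.
  - by exists 1.
  - move=> U V [a a0 aU] [b b0 bV]; exists (Num.min a b).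
      by rewrite lt_min a0.
    by move=> x [/aU|/bV]; rewrite ge_min => ->; rewrite ?orbT.
  - by move=> U V UV [a a0 aV]; exists a => // x /UV/aV.
  - move=> x Kx; have rx : 0 < rho x / 2 by rewrite divr_gt0//; apply: (rho0 x).2.
    exists [set z | `|rho x - rho z| < rho x / 2].
      by have /cvgrPdist_lt := crho x; exact.
    by exists (rho x / 2) => // z /=; rewrite ltr_norml; lra.
(* The maximum with [d] makes the inverse continuous on all of [E], even where [rho] vanishes, and
   changes nothing on [K]. *)
pose psi x : R^o := (Num.max d (rho x))^-1.
have cpsi : continuous psi.
  move=> x; apply: cvgV; first by rewrite gt_eqF// lt_max d0.
  by apply: (@continuous_max R E (fun=> d)); [exact: cvg_cst|exact: crho].
exists (fun x => psi x *: G x) => [|x Kx]; first exact: WG.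
have r0 : 0 < rho x := (rho0 x).2 Kx.
have -> : psi x = (rho x)^-1 by rewrite /psi; congr (_^-1); apply/max_idPr; exact: rhod.
have -> : f x - (rho x)^-1 *: G x = (rho x)^-1 *: (rho x *: f x - G x).
  by rewrite scalerBr scalerA mulVf ?scale1r// gt_eqF.
by rewrite normrZ gtr0_norm ?invr_gt0// mulrC ler_pdivrMr.
Qed.

(** * Positive and negative parts in a vector lattice *)

Section vector_lattice_identities.
Context {R : realType} {V : vectorLatticeType R}.
Implicit Types x y : V.

Lemma vjoin_idPl x y : vle y x -> vjoin x y = x.
Proof.
by move=> yx; apply: vle_anti; rewrite vle_joinP vle_refl yx vle_joinl.
Qed.

Lemma vjoin_idPr x y : vle x y -> vjoin x y = y.
Proof. by rewrite vjoinC; exact: vjoin_idPl. Qed.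

Lemma vpos_ge0 x : vle 0 (vpos x).
Proof. exact: vle_joinr. Qed.

Lemma vneg_ge0 x : vle 0 (vneg x).
Proof. exact: vle_joinr. Qed.

(** Translations preserve joins: adding [x] to the join of [- x] and 0 gives the join of 0 and
    [x]. *)
Lemma vpos_subr_vneg x : vpos x - vneg x = x.
Proof.
suff -> : vpos x = x + vneg x by rewrite addrK.
apply: vle_anti; rewrite vle_joinP; apply/andP; split.
  apply/andP; split.
    by rewrite -{1}(addr0 x); apply: vle_addl; exact: vneg_ge0.
  by rewrite -(subrr x); apply: vle_addl; exact: vle_joinl.
rewrite addrC -[x in vle (_ + x) _]opprK vle_subl vle_joinP.
rewrite -{1}(add0r (- x)) vle_addr ?vpos_ge0//=.
by rewrite -(subrr x) vle_addr// vle_joinl.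
Qed.

Lemma vle_scale_ge0 (a : R) y : 0 <= a -> vle 0 y ->
  vle 0 (a *: y) /\ vle (- (a *: y)) 0.
Proof.
move=> a0 y0; have ay : vle 0 (a *: y) by rewrite -(scaler0 _ a) vle_scale.
by split=> //; rewrite -[0]oppr0 vleN2.
Qed.

(** The sign of [a] decides which of the two parts vanishes. *)
Lemma vposD_vneg_scale (a : R) y : vle 0 y ->
  vpos (a *: y) + vneg (a *: y) = `|a| *: y.
Proof.
move=> y0; rewrite /vpos /vneg; have [a0|a0] := ger0P a.
  have [ay ay'] := vle_scale_ge0 a0 y0.
  by rewrite vjoin_idPl// vjoin_idPr// addr0.
have [] := @vle_scale_ge0 (- a) y _ y0; first by rewrite oppr_ge0 ltW.
rewrite scaleNr opprK => ay ay'.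
by rewrite vjoin_idPr// vjoin_idPl// add0r ?scaleNr.
Qed.

Lemma vabs_scale_ge0 (a : R) y : vle 0 y -> vabs (a *: y) = `|a| *: y.
Proof.
move=> y0; rewrite /vabs; have [a0|a0] := ger0P a.
  have [ay ay'] := vle_scale_ge0 a0 y0.
  rewrite vjoin_idPl//; exact: vle_trans ay.
have [] := @vle_scale_ge0 (- a) y _ y0; first by rewrite oppr_ge0 ltW.
rewrite scaleNr opprK => ay ay'.
rewrite vjoin_idPr// ?scaleNr//; exact: vle_trans ay.
Qed.

End vector_lattice_identities.

(** * Density in the space of continuous maps *)

Section density.
Context {R : realType} {E : tvsType R} {F : banachLatticeType R}.
Implicit Types S : set (cts_space E F).

(** The filter [G], generated by the sets of maps from [S] that are close to [f] on a compact set,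
    converges to [f] uniformly on compact sets. So some generator lies in the open set [W] that
    induces [O], and by hypothesis it is inhabited. *)
Lemma cts_dense S :
  (forall (f : cts_space E F) (K : set E) (e : R), compact K -> 0 < e ->
    exists2 g, S g & forall x, K x -> `|f x - g x| <= e) ->
  dense S.
Proof.
move=> Sapprox O [f Of] [W oW WO].
pose G := filter_from [set Ke : set E * R | compact Ke.1 /\ 0 < Ke.2]
  (fun Ke => [set h : E -> F | (exists2 g, S g & h = g :> (E -> F)) /\
    forall x, Ke.1 x -> `|f x - h x| <= Ke.2]).
have FG : Filter G.
  apply: filter_from_filter; first by exists (set0, 1); split=> //=; exact: compact0.
  move=> [K d] [L e] /= [cK d0] [cL e0]; exists (K `|` L, Num.min d e).
    by split=> /=; [exact: compactU|rewrite lt_min d0].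
  move=> h /= [Sh hKL]; split; split=> // x Kx.
    by have := hKL x (or_introl Kx); rewrite le_min => /andP[].
  by have := hKL x (or_intror Kx); rewrite le_min => /andP[].
have Gf : {family compact, G --> (f : E -> F)}.
  apply/fam_cvgP => K cK U /= /uniform_nbhs[V [entV VU]].
  move: entV; rewrite -entourage_ballE => -[e e0 eV].
  (* Half of [e], since the estimate is a weak inequality and the ball is open. *)
  exists (K, e / 2); first by split=> //=; rewrite divr_gt0.
  move=> h [_ /= fh]; apply: VU => x Kx; apply: eV => /=.
  by rewrite -ball_normE/= (le_lt_trans (fh x Kx))// gtr_pMr// invf_lt1// ltr1n.
have Wf : W (f : E -> F) by rewrite -WO in Of.
have [[K e] /= [cK e0] KW] : G W by apply: Gf; exact: open_nbhs_nbhs.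
have [g Sg fg] := Sapprox f K e cK e0.
exists g; split=> //; rewrite -WO; apply: KW; split=> //.
by exists g.
Qed.

Lemma scalar_scale_cts (T : {scalar E}) (c : R) (y : F) : continuous T ->
  continuous (fun x => (T x - c) *: y).
Proof.
move=> cT x; apply: (@cvgZr_tmp _ F); apply: cvgB; first exact: cT.
exact: cvg_cst.
Qed.

Definition affine_cts (T : {scalar E}) (cT : continuous T) (c : R) (y : F) :
  cts_space E F := mkcts (@scalar_scale_cts T c y cT).

Lemma affine_cts_Aff (T : {scalar E}) (cT : continuous T) c y :
  Aff E F (affine_cts cT c y).
Proof.
have lin : linear (fun x => T x *: y).
  by move=> a u v; rewrite linearP scalerDl scalerA.
pose Ty : {linear E -> F} :=
  HB.pack (fun x => T x *: y) (GRing.isLinear.Build R E F *:%R _ lin).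
exists Ty.
  by move=> x; apply: (@cvgZr_tmp _ F); exact: cT.
by exists (- c *: y) => e; exact: scalerDl.
Qed.

(** Common to both density claims, which differ only in how the maps [|T x - c| *: y] are
    obtained. *)
Lemma dense_of_abs S : hausdorff_space E ->
  submod_closed [in S] ->
  (forall (T : {scalar E}) (cT : continuous T) c y, vle 0 y ->
    exists2 g, S g & forall x, g x = `|T x - c| *: y) ->
  dense S.
Proof.
move=> hE [/set_mem S0 Slin] Sabs; apply: cts_dense => f K e cK.
pose W : set (E -> F) := [set h | exists2 g, S g & h = g :> (E -> F)].
have linW : lin_closed W.
  split; first by exists 0.
  move=> a _ _ [g Sg ->] [h Sh ->]; exists (a *: g + h) => //.
  by apply: set_mem; apply: Slin; exact: mem_set.
have linKW := uapprox_lin K linW.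
suff /(_ e) fW : uapprox K W f by move=> /fW[_ [g Sg ->] fg]; exists g.
(* The maps [psi x *: y] are only shown to be in the closure of [W], so [tensor_uapprox] is applied
   to that closure. *)
apply: (@uapprox_trans _ _ _ K (uapprox K W)) => //.
apply: tensor_uapprox => //; last exact: cts_fun.
have pos_case (psi : E -> R^o) y : continuous psi -> vle 0 y ->
    uapprox K W (fun x => psi x *: y).
  move=> cpsi y0 d d0.
  pose Q : set (E -> R^o) := [set q | W (fun x => q x *: y)].
  have linQ : lin_closed Q.
    split=> [|a p q Wp Wq].
      by have := linW.1; congr W; apply/funext => x; rewrite scale0r.
    have := linW.2 a _ _ Wp Wq.
    by congr W; apply/funext => x; rewrite scalerDl scalerA.
  have y1 : 0 < `|y| + 1 by rewrite ltr_wpDl.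
  have [T cT c|q Qq qpsi] :=
      @abs_affine_uapprox R E Q K psi hE cK linQ _ cpsi (d / (`|y| + 1)) (divr_gt0 d0 y1).
    have [g Sg gE] := Sabs T cT c y y0.
    by exists g => //; apply/funext => x; rewrite gE.
  exists (fun x => q x *: y) => // x Kx.
  rewrite -scalerBl normrZ (@le_trans _ _ (d / (`|y| + 1) * `|y|))//.
    by rewrite ler_wpM2r// qpsi.
  by rewrite mulrAC ler_pdivrMr// ler_pM2l// lerDl.
move=> psi y cpsi.
have := lin_closedB linKW (pos_case psi (vpos y) cpsi (vpos_ge0 y))
  (pos_case psi (vneg y) cpsi (vneg_ge0 y)).
congr (uapprox _ _ _); apply/funext => x.
by rewrite -scalerBr vpos_subr_vneg.
Qed.

End density.

Lemma linear_span_submod {R : numDomainType} {V : lmodType R} (A : set V) :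
  submod_closed [in linear_span A].
Proof.
split=> [|a u v /set_mem Au /set_mem Av]; apply: mem_set => B [].
  by move=> [/set_mem].
move=> sB AB; apply: set_mem.
by apply: sB.2; apply: mem_set; [exact: Au|exact: Av].
Qed.

Lemma vlt_vector_sublattice {R : numDomainType} {V : vectorLatticeType R}
  (A : set V) : vector_sublattice (vlt A).
Proof.
split.
- split=> [|a u v /set_mem Au /set_mem Av]; apply: mem_set => B [].
    by move=> [[/set_mem]].
  move=> sB AB; have [[_ lB] _ _] := sB; apply: set_mem.
  by apply: lB; apply: mem_set; [exact: Au|exact: Av].
- move=> x y Ax Ay B BA; have [[_ jB _] _] := BA.
  by apply: jB; [exact: Ax|exact: Ay].
- move=> x y Ax Ay B BA; have [[_ _ mB] _] := BA.
  by apply: mB; [exact: Ax|exact: Ay].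
Qed.

Theorem theorem3p10 (R : realType) (E : tvsType R) (F : banachLatticeType R)
    (E_nontrivial : exists e : E, e != 0) (F_nontrivial : exists f : F, f != 0)
    (E_hausdorff : hausdorff_space E) (r s : R) (s_neq : s != - r) :
  dense (linear_span
    [set (pos_neg_comb r s \o g : cts_space E F) | g in Aff E F]) /\
  dense (vlt (Aff E F)).
Proof.
split.
- apply: dense_of_abs => //; first exact: linear_span_submod.
  move=> T cT c y y0.
  have rs : r + s != 0 by rewrite addrC addr_eq0.
  set S := linear_span _.
  have [_ Slin] : submod_closed [in S] by exact: linear_span_submod.
  have S0 : 0 \in S by have [] : submod_closed [in S] by exact: linear_span_submod.
  have SPhi z : (pos_neg_comb r s \o affine_cts cT c z : cts_space E F) \in S.
    apply: mem_set; apply: sub_gen_smallest.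
    by exists (affine_cts cT c z) => //; exact: affine_cts_Aff.
  (* For [z = (T x - c) *: y] this is [(r + s)^-1] times the sum of the values at [z] and [- z];
     [1 *:] and [+ 0] fit the form [a *: u + v] of the closure property. *)
  exists ((r + s)^-1 *: (1 *: (pos_neg_comb r s \o affine_cts cT c y : cts_space E F) +
    (pos_neg_comb r s \o affine_cts cT c (- y) : cts_space E F)) + 0).
    by apply: set_mem; apply: (@Slin) => //; exact: Slin.
  move=> x.
  transitivity ((r + s)^-1 *: (1 *: pos_neg_comb r s ((T x - c) *: y) +
    pos_neg_comb r s ((T x - c) *: - y)) + 0); first by [].
  rewrite addr0 scale1r scalerN /pos_neg_comb.
  set a := T x - c; set p := vpos (a *: y); set n := vneg (a *: y).
  (* Passing to [- z] exchanges the two parts; [vpos (- z)] is [vneg z] by definition. *)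
  have -> : vneg (- (a *: y)) = p by rewrite /vneg opprK.
  have -> : r *: p + s *: n + (r *: n + s *: p) = (r + s) *: (p + n).
    by rewrite scalerDl !scalerDr addrACA (addrC (s *: n)).
  by rewrite scalerA mulVf// scale1r vposD_vneg_scale.
- have [Asub Ajoin _] := vlt_vector_sublattice (Aff E F).
  apply: dense_of_abs => // T cT c y y0.
  exists (vjoin (affine_cts cT c y) (affine_cts cT c (- y))).
    by apply: Ajoin; apply: sub_gen_smallest; exact: affine_cts_Aff.
  move=> x; transitivity (vjoin ((T x - c) *: y) ((T x - c) *: - y)); first by [].
  by rewrite scalerN; exact: vabs_scale_ge0.
Qed.
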